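(* Let $m,s,t$ be positive integers with $m=s+t$ and $s<t$, let $u\ge 2t$ be an even integer, and let $H=(h_1,\dots,h_t):\mathbb{F}_2^u\to\mathbb{F}_2^t$ be a vectorial bent function. For $c,\alpha\in\mathbb{F}_2^t$ let $S_{c,\alpha}$ (sequences of length $2^m$) and $S'_{c,\alpha}$ (sequences of length $2^{m+u}$) be the sets defined in the context. Then, for $c,\alpha\in\mathbb{F}_2^t$: (i) For any fixed $e,\delta\in\mathbb{F}_2^t$, $S'_{c,\alpha}\perp S'_{e,\delta}$ if and only if $S_{c,\alpha}\perp S_{e,\delta}$. (ii) All the sequences in $S'_{c,\alpha}$ are (pairwise) orthogonal plateaued sequences, and $\#S'_{c,\alpha}/\#S_{c,\alpha}=2^u$. (iii) For $t=\lfloor (m+2)/2\rfloor$, the sequences of $S'_{c,\alpha}$ are semi-bent, and the maximum correlation (absolute value of the inner product) between two distinct non-orthogonal sequences from the sets $S'_{c,\alpha}$, $c,\alpha\in\mathbb{F}_2^t$, is equal to $2^{\lfloor (m+u+2)/2\rfloor}$.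
   Context: Boolean functions and sequences. $\mathcal{B}_n$ denotes the set of functions $f:\mathbb{F}_2^n\to\mathbb{F}_2$. For $a,b\in\mathbb{F}_2^n$, $a\cdot b=\sum_i a_ib_i\in\mathbb{F}_2$. The Walsh–Hadamard transform of $f\in\mathcal{B}_n$ is $W_f(\omega)=\sum_{x\in\mathbb{F}_2^n}(-1)^{f(x)+\omega\cdot x}$. The function $f\in\mathcal{B}_n$ is bent if $W_f(\omega)\in\{\pm 2^{n/2}\}$ for all $\omega$; it is plateaued if there is a positive integer $\lambda\ge n/2$ with $W_f(\omega)\in\{0,\pm 2^{\lambda}\}$ for all $\omega$; it is semi-bent if this holds with $\lambda=\lfloor (n+2)/2\rfloor$. A function $H=(h_1,\dots,h_t):\mathbb{F}_2^u\to\mathbb{F}_2^t$ is vectorial bent if every nonzero $\mathbb{F}_2$-linear combination of $h_1,\dots,h_t$ is bent. The sequence of $f\in\mathcal{B}_n$ is the $(1,-1)$-sequence $\overline{f}=((-1)^{f(x)})_{x\in\mathbb{F}_2^n}$ of length $2^n$; it is a plateaued (semi-bent) sequence if $f$ is plateaued (semi-bent). The inner product is $\overline{f_1}\cdot\overline{f_2}=\sum_x(-1)^{f_1(x)+f_2(x)}\in\mathbb{Z}$, and $\overline{f_1},\overline{f_2}$ are orthogonal if it is $0$. For two sets of sequences, $S_1\perp S_2$ means that every sequence of $S_1$ is orthogonal to every sequence of $S_2$. Componentwise product: $\overline{f_1}*\overline{f_2}=\overline{f_1+f_2}$. The sets $S_{c,\alpha}$. Let $\gamma$ be a primitive element of $\mathbb{F}_{2^t}$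 and let $\pi:\mathbb{F}_{2^t}\to\mathbb{F}_2^t$ be the linear isomorphism $\pi(b_1+b_2\gamma+\cdots+b_t\gamma^{t-1})=(b_1,\dots,b_t)$. For $y\in\mathbb{F}_2^s$ let $[y]=\sum_{j=1}^s y_j2^{j-1}$ (an integer). For $i=1,\dots,t$ define $f_i:\mathbb{F}_2^s\times\mathbb{F}_2^t\to\mathbb{F}_2$ by $f_i(y,x)=\pi(\gamma^{[y]+i})\cdot x$. For $c\in\mathbb{F}_2^t$ let $f_c=c_1f_1+\cdots+c_tf_t$. For $\alpha\in\mathbb{F}_2^t$ let $L_\alpha=\{(y,x)\mapsto\beta\cdot y+\alpha\cdot x\mid \beta\in\mathbb{F}_2^s\}$, and $S_{c,\alpha}=\{\overline{f_c}*\overline{l}\mid l\in L_\alpha\}$. The sets $S'_{c,\alpha}$. For $c\in\mathbb{F}_2^t$ let $h_c=c_1h_1+\cdots+c_th_t$ and define $g_c\in\mathcal{B}_{m+u}$ by $g_c(z,y,x)=h_c(z)+f_c(y,x)$ for $z\in\mathbb{F}_2^u$, $y\in\mathbb{F}_2^s$, $x\in\mathbb{F}_2^t$. For $\alpha\in\mathbb{F}_2^t$ let $L'_\alpha=\{(z,y,x)\mapsto\beta'\cdot z+\beta\cdot y+\alpha\cdot x\mid\beta'\in\mathbb{F}_2^u,\ \beta\in\mathbb{F}_2^s\}$, and $S'_{c,\alpha}=\{\overline{g_c}*\overline{l'}\mid l'\in L'_\alpha\}$.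
   Formalization: In (iii), the claim that the sequences of S'_{c,α} are semi-bent is stated only for c ≠ 0; for c = 0 these are sequences of linear functions, whose Walsh transform takes the value 2^{m+u}, so they are not semi-bent. *)

(* Defs.v *)
From HB Require Import structures.
From mathcomp Require Import all_boot all_order all_algebra finmap.

Set Implicit Arguments.
Unset Strict Implicit.
Unset Printing Implicit Defensive.

Import Order.TTheory GRing.Theory Num.Theory.
Local Open Scope ring_scope.

(* F_2^n is 'rV['F_2]_n.  A product such as F_2^s x F_2^t is identified with   *)
(* 'rV['F_2]_(s + t) by concatenation: (y, x) is row_mx y x, so that y and x   *)
(* are recovered by lsubmx and rsubmx.                                        *)
Definition boolfun (n : nat) := {ffun 'rV['F_2]_n -> 'F_2}.

Definition sequence (n : nat) := {ffun 'rV['F_2]_n -> int}.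

Definition dot (n : nat) (a b : 'rV['F_2]_n) : 'F_2 :=
  \sum_(i < n) a 0 i * b 0 i.

(* The exponent is the representative of the bit in {0, 1}. *)
Definition sgn (b : 'F_2) : int := (-1) ^+ (b : nat).

Definition walsh (n : nat) (f : boolfun n) (w : 'rV['F_2]_n) : int :=
  \sum_x sgn (f x + dot w x).

(* For odd n the number 2^(n/2) is irrational, so no function is bent. *)
Definition bent (n : nat) (f : boolfun n) : Prop :=
  ~~ odd n /\
  forall w, walsh f w = 2 ^+ (n %/ 2) \/ walsh f w = - 2 ^+ (n %/ 2).

Definition plateaued_with (n lam : nat) (f : boolfun n) : Prop :=
  forall w, [\/ walsh f w = 0, walsh f w = 2 ^+ lam | walsh f w = - 2 ^+ lam].

(* lam >= n/2 is a comparison of rationals, hence n <= 2 lam. *)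
Definition plateaued (n : nat) (f : boolfun n) : Prop :=
  exists lam : nat, [/\ (0 < lam)%N, (n <= 2 * lam)%N & plateaued_with lam f].

Definition semibent (n : nat) (f : boolfun n) : Prop :=
  plateaued_with ((n + 2) %/ 2) f.

Definition lincomb (n t : nat) (c : 'rV['F_2]_t) (h : 'I_t -> boolfun n) :
    boolfun n :=
  [ffun x => \sum_(i < t) c 0 i * h i x].

Definition component (u t : nat) (H : 'rV['F_2]_u -> 'rV['F_2]_t) (i : 'I_t) :
    boolfun u :=
  [ffun z => H z 0 i].

Definition vectorial_bent (u t : nat) (H : 'rV['F_2]_u -> 'rV['F_2]_t) : Prop :=
  forall c : 'rV['F_2]_t, c != 0 -> bent (lincomb c (component H)).

Definition seq_of (n : nat) (f : boolfun n) : sequence n :=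
  [ffun x => sgn (f x)].

Definition plateaued_seq (n : nat) (a : sequence n) : Prop :=
  exists2 f : boolfun n, a = seq_of f & plateaued f.

Definition semibent_seq (n : nat) (a : sequence n) : Prop :=
  exists2 f : boolfun n, a = seq_of f & semibent f.

Definition inner (n : nat) (a b : sequence n) : int := \sum_x a x * b x.

Definition orthogonal_seq (n : nat) (a b : sequence n) : Prop := inner a b = 0.

Definition orthogonal_sets (n : nat) (S1 S2 : {fset sequence n}) : Prop :=
  forall a b : sequence _, a \in S1 -> b \in S2 -> orthogonal_seq a b.

Definition seq_mul (n : nat) (a b : sequence n) : sequence n :=
  [ffun x => a x * b x].

Definition nat_of_bits (s : nat) (y : 'rV['F_2]_s) : nat :=
  (\sum_(j < s) (y 0%R j : nat) * 2 ^ j)%N.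

(* The coordinate map of F in the basis 1, gamma, ..., gamma^(t-1).  As F has *)
(* characteristic 2, additive maps are exactly the F_2-linear ones, and       *)
(* gamma^i *+ b is b gamma^i.                                                 *)
Definition basis_coordinates (F : finFieldType) (t : nat) (gamma : F)
    (pi : {additive F -> 'rV['F_2]_t}) : Prop :=
  bijective pi /\
  forall b : 'rV['F_2]_t, pi (\sum_(i < t) gamma ^+ i *+ (b 0 i : nat)) = b.

Section Construction.

Variables (F : finFieldType) (s t u : nat).
Variables (gamma : F) (pi : {additive F -> 'rV['F_2]_t}).
Variable (H : 'rV['F_2]_u -> 'rV['F_2]_t).

(* Indices in 'I_t start at 0, whence i.+1. *)
Definition f_ (i : 'I_t) : boolfun (s + t) :=
  [ffun v => dot (pi (gamma ^+ (nat_of_bits (lsubmx v) + i.+1))) (rsubmx v)].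

Definition fc (c : 'rV['F_2]_t) : boolfun (s + t) := lincomb c f_.

Definition Lset (alpha : 'rV['F_2]_t) : {set boolfun (s + t)} :=
  [set [ffun v => dot beta (lsubmx v) + dot alpha (rsubmx v)]
     | beta : 'rV['F_2]_s].

Definition Sset (c alpha : 'rV['F_2]_t) : {fset sequence (s + t)} :=
  [fset seq_mul (seq_of (fc c)) (seq_of l) | l in Lset alpha]%fset.

Definition gc (c : 'rV['F_2]_t) : boolfun (u + (s + t)) :=
  [ffun v => lincomb c (component H) (lsubmx v) + fc c (rsubmx v)].

Definition Lset' (alpha : 'rV['F_2]_t) : {set boolfun (u + (s + t))} :=
  [set [ffun v => dot beta' (lsubmx v) + dot beta (lsubmx (rsubmx v))
                  + dot alpha (rsubmx (rsubmx v))]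
     | beta' : 'rV['F_2]_u, beta : 'rV['F_2]_s].

Definition Sset' (c alpha : 'rV['F_2]_t) : {fset sequence (u + (s + t))} :=
  [fset seq_mul (seq_of (gc c)) (seq_of l) | l in Lset' alpha]%fset.

End Construction.

(* Main.v *)
(* Both sets consist of sequences of functions f + w.x, and the inner product
   of two such sequences is a Walsh coefficient:
   <f + v.x, g + w.x> = W_{f+g}(v + w).  Since f_c + f_e = f_{c+e},
   g_c + g_e = g_{c+e} and W_{g_c}(w, v) = W_{h_c}(w) W_{f_c}(v), everything
   reduces to the spectra of h_c and f_c.  For c <> 0 the former takes the
   values +-2^(u/2), while f_c(y, x) = phi_c(y).x where
   phi_c(y) = pi(gamma^[y] kappa(c)) is injective (as 2^s <= 2^t - 1), so f_c
   is of Maiorana-McFarland type with spectrum in {0, +-2^t}. *)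

Require Import Defs.
From HB Require Import structures.
From mathcomp Require Import all_boot all_order all_algebra finmap.

Set Implicit Arguments.
Unset Strict Implicit.
Unset Printing Implicit Defensive.

Import Order.TTheory GRing.Theory Num.Theory.
Local Open Scope ring_scope.

(** * Arithmetic of ['F_2], signs, dot products and the basic character sum *)

Lemma F2_cases (a : 'F_2) : a = 0 \/ a = 1.
Proof.
by case: a => [] [|[|k]] ltk //; [left | right]; apply/val_inj.
Qed.

Lemma addF2 (a : 'F_2) : a + a = 0.
Proof. by case: (F2_cases a) => ->; apply/val_inj. Qed.

Lemma rowF2D (n : nat) (a : 'rV['F_2]_n) : a + a = 0.
Proof. by apply/rowP => i; rewrite !mxE addF2. Qed.

Lemma rowF2_eq (n : nat) (a b : 'rV['F_2]_n) : (a + b == 0) = (a == b).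
Proof.
rewrite addr_eq0 (_ : - b = b) //.
by apply/eqP; rewrite eq_sym -addr_eq0 rowF2D.
Qed.

Lemma card_rowF2 (n : nat) : #|{: 'rV['F_2]_n}| = (2 ^ n)%N.
Proof. by rewrite card_mx card_ord mul1n. Qed.

Lemma sgn0 : sgn 0 = 1. Proof. by []. Qed.

Lemma sgn1 : sgn 1 = -1. Proof. by []. Qed.

Lemma sgnD (a b : 'F_2) : sgn (a + b) = sgn a * sgn b.
Proof. by case: (F2_cases a) => ->; case: (F2_cases b) => ->. Qed.

Lemma sgn_inj : injective sgn.
Proof. by move=> a b; case: (F2_cases a) => ->; case: (F2_cases b) => ->. Qed.

Lemma sgn_cases (a : 'F_2) : sgn a = 1 \/ sgn a = -1.
Proof. by case: (F2_cases a) => ->; [left | right]. Qed.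

Lemma dot0l (n : nat) (a : 'rV['F_2]_n) : dot 0 a = 0.
Proof. by rewrite /dot big1 // => i _; rewrite mxE mul0r. Qed.

Lemma dotDl (n : nat) (a b x : 'rV['F_2]_n) : dot (a + b) x = dot a x + dot b x.
Proof.
by rewrite /dot -big_split; apply: eq_bigr => i _; rewrite mxE mulrDl.
Qed.

Lemma dotMn (n k : nat) (a x : 'rV['F_2]_n) : dot (a *+ k) x = dot a x *+ k.
Proof. by elim: k => [|k IHk]; rewrite ?dot0l // !mulrS dotDl IHk. Qed.

Lemma dotDr (n : nat) (a x y : 'rV['F_2]_n) : dot a (x + y) = dot a x + dot a y.
Proof.
by rewrite /dot -big_split; apply: eq_bigr => i _; rewrite mxE mulrDr.
Qed.

Lemma dot_delta (n : nat) (a : 'rV['F_2]_n) (i : 'I_n) :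
  dot a (delta_mx 0 i) = a 0 i.
Proof.
rewrite /dot (bigD1 i) //= big1 => [|j ne]; rewrite mxE ?eqxx ?addr0 ?mulr1 //.
by rewrite (negPf ne) mulr0.
Qed.

Lemma dot_inj (n : nat) (a b : 'rV['F_2]_n) : dot a =1 dot b -> a = b.
Proof. by move=> e; apply/rowP => i; rewrite -!dot_delta e. Qed.

Lemma dot_row_mx (m n : nat) (a : 'rV['F_2]_m) (b : 'rV['F_2]_n) v :
  dot (row_mx a b) v = dot a (lsubmx v) + dot b (rsubmx v).
Proof.
rewrite /dot big_split_ord; congr (_ + _); apply: eq_bigr => i _.
  by rewrite row_mxEl mxE.
by rewrite row_mxEr mxE.
Qed.

Lemma sum_row_mx (m n : nat) (G : 'rV['F_2]_(m + n) -> int) :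
  \sum_v G v = \sum_y \sum_x G (row_mx y x).
Proof.
rewrite pair_big.
rewrite (reindex (fun p : 'rV_m * 'rV_n => row_mx p.1 p.2)) //=.
exists (fun v => (lsubmx v, rsubmx v)) => [[y x] _|v _] /=.
  by rewrite row_mxKl row_mxKr.
exact: hsubmxK.
Qed.

(** If [a] is nonzero, translating [x] by a unit vector on which [a] is 1 flips the sign of every
    term, so the sum equals its own opposite. *)
Lemma sum_sgn_dot (n : nat) (a : 'rV['F_2]_n) :
  \sum_x sgn (dot a x) = if a == 0 then 2 ^+ n else 0.
Proof.
have [->|] := eqVneq a 0.
  under eq_bigr do rewrite dot0l sgn0.
  by rewrite sumr_const card_rowF2 -natrX.
case/rV0Pn => i nz; set S := \sum_x _.
have ai : a 0 i = 1 by case: (F2_cases (a 0 i)) nz => ->.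
suff: S = - S by move=> /eqP; rewrite -addr_eq0 -mulr2n mulrn_eq0 => /eqP.
rewrite {1}/S (reindex_inj (addrI (delta_mx 0 i))) -sumrN.
by apply: eq_bigr => x _; rewrite dotDr dot_delta ai sgnD sgn1 mulN1r.
Qed.

(** * Linear twists of Boolean functions, their Walsh spectra and inner products *)

(** Common form of the members of both families: twisting by a linear form translates the Walsh
    spectrum, so spectral properties need only be checked on [fc] and [gc]. *)
Definition twist (n : nat) (f : boolfun n) (w : 'rV['F_2]_n) : boolfun n :=
  [ffun v => f v + dot w v].

Lemma twist_inj (n : nat) (f : boolfun n) : injective (twist f).
Proof.
move=> v w e; apply: dot_inj => x; apply: (addrI (f x)).
by move/ffunP/(_ x): e; rewrite !ffunE.
Qed.

Lemma seq_of_inj (n : nat) : injective (@seq_of n).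
Proof.
move=> f g e; apply/ffunP => x; apply: sgn_inj.
by move/ffunP/(_ x): e; rewrite !ffunE.
Qed.

Lemma boolfunDE (n : nat) (f g : boolfun n) (x : 'rV['F_2]_n) :
  (f + g) x = f x + g x.
Proof. by rewrite ffunE. Qed.

Lemma seq_mul_seq_of (n : nat) (f g : boolfun n) :
  seq_mul (seq_of f) (seq_of g) = seq_of (f + g).
Proof. by apply/ffunP => x; rewrite !ffunE sgnD. Qed.

Lemma walsh_twist (n : nat) (f : boolfun n) (v w : 'rV['F_2]_n) :
  walsh (twist f v) w = walsh f (v + w).
Proof. by apply: eq_bigr => x _; rewrite ffunE dotDl addrA. Qed.

Lemma inner_twist (n : nat) (f g : boolfun n) (v w : 'rV['F_2]_n) :
  inner (seq_of (twist f v)) (seq_of (twist g w)) = walsh (f + g) (v + w).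
Proof.
by apply: eq_bigr => x _; rewrite !ffunE -sgnD dotDl addrACA.
Qed.

Lemma walsh0 (n : nat) (w : 'rV['F_2]_n) :
  walsh (0 : boolfun n) w = if w == 0 then 2 ^+ n else 0.
Proof. by rewrite -sum_sgn_dot; apply: eq_bigr => x _; rewrite ffunE add0r. Qed.

(** In characteristic 2 the two copies of [f] cancel, leaving the spectrum of the zero function,
    which is supported at the origin; distinct sequences have [v <> w], hence [v + w] is off the
    origin. *)
Lemma inner_twist_same (n : nat) (f : boolfun n) v w :
  seq_of (twist f v) <> seq_of (twist f w) ->
  orthogonal_seq (seq_of (twist f v)) (seq_of (twist f w)).
Proof.
move=> ne; rewrite /orthogonal_seq inner_twist.
have -> : f + f = 0 by apply/ffunP => x; rewrite !ffunE addF2.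
by rewrite walsh0 rowF2_eq; case: eqVneq => // e; case: ne; rewrite e.
Qed.

Lemma plateaued_with_twist (n lam : nat) (f : boolfun n) (w : 'rV['F_2]_n) :
  plateaued_with lam f -> plateaued_with lam (twist f w).
Proof. by move=> pf v; rewrite walsh_twist. Qed.

(** Serves the degenerate index [c = 0], where [gc] vanishes and its twists are linear functions. *)
Lemma plateaued_with0 (n : nat) : plateaued_with n (0 : boolfun n).
Proof.
by move=> w; rewrite walsh0; case: ifP => _; [constructor 2 | constructor 1].
Qed.

Lemma lincomb0 (n t : nat) (h : 'I_t -> boolfun n) : lincomb 0 h = 0.
Proof.
by apply/ffunP => x; rewrite !ffunE big1 // => i _; rewrite mxE mul0r.
Qed.

Lemma lincombD (n t : nat) (c e : 'rV['F_2]_t) (h : 'I_t -> boolfun n) :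
  lincomb c h + lincomb e h = lincomb (c + e) h.
Proof.
apply/ffunP => x; rewrite !ffunE -big_split.
by apply: eq_bigr => i _; rewrite mxE mulrDl.
Qed.

(** * Binary expansions: range and injectivity of [nat_of_bits] *)

Lemma binary_sum_lt (s : nat) (f : 'I_s -> nat) :
  (forall i, f i < 2)%N -> (\sum_(j < s) f j * 2 ^ j < 2 ^ s)%N.
Proof.
elim: s f => [|s IHs] f f2; first by rewrite big_ord0.
rewrite big_ord_recr /= expnS mul2n -addnn -addSn leq_add //.
  exact: (IHs (fun i => f (widen_ord (leqnSn s) i))).
by case: (f ord_max) (f2 ord_max) => [|[|]] // _; rewrite mul1n.
Qed.

(** Induction on the least significant bit: reduction mod 2 identifies it, and cancelling it and
    dividing by 2 leaves the shorter expansions. *)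
Lemma binary_sum_inj (s : nat) (f g : 'I_s -> nat) :
  (forall i, f i < 2)%N -> (forall i, g i < 2)%N ->
  (\sum_(j < s) f j * 2 ^ j = \sum_(j < s) g j * 2 ^ j)%N -> f =1 g.
Proof.
elim: s f g => [|s IHs] f g f2 g2; first by move=> _ [].
have shift (k : 'I_s.+1 -> nat) : (\sum_(j < s.+1) k j * 2 ^ j =
    (\sum_(j < s) k (lift ord0 j) * 2 ^ j) * 2 + k ord0)%N.
  rewrite big_ord_recl /= expn0 muln1 addnC; congr (_ + _)%N.
  rewrite big_distrl; apply: eq_bigr => i _ /=.
  by rewrite expnSr mulnA.
rewrite !shift => e.
have e0 : f ord0 = g ord0.
  by move/(congr1 (modn^~ 2)): e; rewrite !modnMDl !modn_small.
move: e; rewrite e0 => /addIn /eqP; rewrite eqn_pmul2r // => /eqP e.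
move=> i; have [j ->|->] := unliftP ord0 i; last by [].
by apply: (IHs (fun j => f (lift ord0 j)) (fun j => g (lift ord0 j))).
Qed.

Lemma ltn_F2 (a : 'F_2) : (a < 2)%N.
Proof. exact: ltn_ord. Qed.

Lemma nat_of_bits_lt (s : nat) (y : 'rV['F_2]_s) : (nat_of_bits y < 2 ^ s)%N.
Proof. by apply: binary_sum_lt => i; apply: ltn_F2. Qed.

Lemma nat_of_bits_inj (s : nat) : injective (@nat_of_bits s).
Proof.
move=> y z e; apply/rowP => i; apply/val_inj.
by apply: (binary_sum_inj _ _ e) => j; apply: ltn_F2.
Qed.

(** * The sets as families of twists, and their cardinalities *)

Section Sets.

Variables (s t u : nat) (F : finFieldType) (gamma : F).
Variables (pi : {additive F -> 'rV['F_2]_t}) (H : 'rV['F_2]_u -> 'rV['F_2]_t).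
Implicit Types (c e alpha delta : 'rV['F_2]_t) (beta : 'rV['F_2]_s).

Local Notation fc := (fc s gamma pi).
Local Notation gc := (gc s gamma pi H).
Local Notation hc c := (lincomb c (component H)).

Lemma fc0 : fc 0 = 0. Proof. exact: lincomb0. Qed.

Lemma fcD c e : fc c + fc e = fc (c + e). Proof. exact: lincombD. Qed.

Lemma gc0 : gc 0 = 0.
Proof. by apply/ffunP => v; rewrite ffunE fc0 lincomb0 !ffunE addr0. Qed.

Lemma gcE c v : gc c v = hc c (lsubmx v) + fc c (rsubmx v).
Proof. by rewrite ffunE. Qed.

Lemma gcD c e : gc c + gc e = gc (c + e).
Proof.
apply/ffunP => v; rewrite boolfunDE !gcE -fcD -lincombD.
by rewrite [in RHS]boolfunDE [in RHS]boolfunDE addrACA.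
Qed.

(** The sign is a product of a factor in [z] and a factor in [(y, x)], so the double sum splits. *)
Lemma walsh_gc c (w : 'rV_u) (v : 'rV_(s + t)) :
  walsh (gc c) (row_mx w v) = walsh (hc c) w * walsh (fc c) v.
Proof.
rewrite /walsh sum_row_mx big_distrl /=; apply: eq_bigr => z _.
rewrite big_distrr; apply: eq_bigr => x _ /=.
by rewrite gcE dot_row_mx row_mxKl row_mxKr -sgnD addrACA.
Qed.

Lemma SsetP c alpha a :
  reflect (exists beta, a = seq_of (twist (fc c) (row_mx beta alpha)))
    (a \in Sset s gamma pi c alpha).
Proof.
apply: (iffP (imfsetP _ _ _ _)) => /= [[l /imsetP[beta _ ->] ->]|[beta ->]].
  exists beta; rewrite seq_mul_seq_of; congr seq_of.
  by apply/ffunP => x; rewrite [RHS]ffunE dot_row_mx 2!ffunE.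
exists [ffun v => dot beta (lsubmx v) + dot alpha (rsubmx v)].
  exact: imset_f.
rewrite seq_mul_seq_of; congr seq_of.
by apply/ffunP => x; rewrite ffunE dot_row_mx [RHS]ffunE [in RHS]ffunE.
Qed.

Lemma Sset'P c alpha a :
  reflect (exists (w : 'rV_u) beta,
             a = seq_of (twist (gc c) (row_mx w (row_mx beta alpha))))
    (a \in Sset' s gamma pi H c alpha).
Proof.
apply: (iffP (imfsetP _ _ _ _)) => /=
  [[l /imset2P[w beta _ _ ->] ->]|[w [beta ->]]].
  exists w, beta; rewrite seq_mul_seq_of; congr seq_of.
  by apply/ffunP => x; rewrite [RHS]ffunE !dot_row_mx 2!ffunE !addrA.
exists [ffun v => dot w (lsubmx v) + dot beta (lsubmx (rsubmx v))
                  + dot alpha (rsubmx (rsubmx v))].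
  exact: imset2_f.
rewrite seq_mul_seq_of; congr seq_of.
by apply/ffunP => x; rewrite ffunE !dot_row_mx [RHS]ffunE [in RHS]ffunE !addrA.
Qed.

(** The signs determine the Boolean function, which determines the twisting vector, so [beta] can be
    recovered from the sequence. *)
Lemma card_Sset c alpha : #|` Sset s gamma pi c alpha| = (2 ^ s)%N.
Proof.
have inj : injective (fun beta => seq_of (twist (fc c) (row_mx beta alpha))).
  by move=> b b' /seq_of_inj /twist_inj /eq_row_mx [].
rewrite (_ : Sset _ _ _ _ _ = [fset seq_of (twist (fc c) (row_mx beta alpha))
                                 | beta in {: 'rV['F_2]_s}]%fset).
  by rewrite card_imfset //= -cardE card_rowF2.
apply/fsetP => a; apply/SsetP/imfsetP => /= [[b ->]|[b _ ->]]; exists b => //.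
Qed.

Lemma card_Sset' c alpha : #|` Sset' s gamma pi H c alpha| = (2 ^ (u + s))%N.
Proof.
pose tw (p : 'rV['F_2]_u * 'rV['F_2]_s) :=
  seq_of (twist (gc c) (row_mx p.1 (row_mx p.2 alpha))).
have inj : injective tw.
  move=> [w b] [w' b'] /seq_of_inj /twist_inj /eq_row_mx [/= -> e].
  by case: (eq_row_mx e) => ->.
rewrite (_ : Sset' _ _ _ _ _ _ =
             [fset tw p | p in {: 'rV['F_2]_u * 'rV['F_2]_s}]%fset).
  by rewrite card_imfset //= -cardE card_prod !card_rowF2 expnD.
apply/fsetP => a; apply/Sset'P/imfsetP => /= [[w [b ->]]|[[w b] _ ->]].
  by exists (w, b).
by exists w, b.
Qed.

(** * The Maiorana-McFarland structure and the spectrum of [fc] *)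

Hypothesis s_lt_t : (s < t)%N.
Hypothesis gamma_prim : ((2 ^ t).-1).-primitive_root gamma.
Hypothesis pi_coord : basis_coordinates gamma pi.

(** This is [gamma] times the field element with coordinate vector [c]; the extra factor comes from
    the exponents [i.+1] in [f_]. *)
Definition kappa c : F := \sum_(i < t) gamma ^+ i.+1 *+ (c 0 i : nat).

Lemma gamma_neq0 : gamma != 0.
Proof.
apply/eqP => g0; have /eqP := prim_expr_order gamma_prim.
by rewrite g0 expr0n gtn_eqF ?(prim_order_gt0 gamma_prim) // eq_sym oner_eq0.
Qed.

Lemma kappa_neq0 c : c != 0 -> kappa c != 0.
Proof.
have -> : kappa c = gamma * \sum_(i < t) gamma ^+ i *+ (c 0 i : nat).
  by rewrite big_distrr; apply: eq_bigr => i _; rewrite /= mulrnAr exprS.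
rewrite mulf_eq0 (negPf gamma_neq0); apply: contra => /eqP s0.
by rewrite -(proj2 pi_coord c) s0 raddf0.
Qed.

Definition phi c (y : 'rV['F_2]_s) : 'rV['F_2]_t :=
  pi (gamma ^+ nat_of_bits y * kappa c).

Lemma phi_inj c : c != 0 -> injective (phi c).
Proof.
move=> /kappa_neq0 nz y z /(bij_inj (proj1 pi_coord)) /(mulIf nz) /eqP.
(* Strictness of [s < t] gives [2^s <= 2^t - 1], the order of [gamma], so exponents that agree
   modulo the order are equal. *)
have lt (x : 'rV['F_2]_s) : (nat_of_bits x < (2 ^ t).-1)%N.
  apply: leq_trans (nat_of_bits_lt x) _.
  by rewrite -ltnS prednK ?expn_gt0 // ltn_exp2l.
rewrite (eq_prim_root_expr gamma_prim) !modn_small // => /eqP.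
exact: nat_of_bits_inj.
Qed.

(** Additivity of [pi] and of the dot product gathers the vectors attached to the [f_ i] into the
    single vector [phi c y]. *)
Lemma fcE c y x : fc c (row_mx y x) = dot (phi c y) x.
Proof.
rewrite ffunE /phi big_distrr raddf_sum /=.
rewrite (big_morph (@dot t ^~ x) (fun a b => dotDl a b x) (dot0l x)).
apply: eq_bigr => i _; rewrite ffunE row_mxKl row_mxKr.
(* The bit [c 0 i] is a multiplicity inside [kappa] but a scalar inside [lincomb]; [natr_Zp]
   identifies the two. *)
rewrite mulrnAr -exprD raddfMn dotMn -mulr_natl; congr (_ * _).
by rewrite natr_Zp.
Qed.

(** For fixed [y] the sum over [x] is the character sum of [phi c y + alpha], which vanishes unless
    [phi c y = alpha]. *)
Lemma walsh_fc c beta alpha :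
  walsh (fc c) (row_mx beta alpha)
  = 2 ^+ t * \sum_(y | phi c y == alpha) sgn (dot beta y).
Proof.
rewrite /walsh sum_row_mx big_distrr [RHS]big_mkcond /=; apply: eq_bigr => y _.
transitivity (sgn (dot beta y) * \sum_x sgn (dot (phi c y + alpha) x)).
  rewrite big_distrr; apply: eq_bigr => x _.
  by rewrite /= -sgnD fcE dot_row_mx row_mxKl row_mxKr dotDl addrCA.
by rewrite sum_sgn_dot rowF2_eq mulrC; case: ifP; rewrite ?mul0r.
Qed.

Lemma walsh_fc_phi c y beta : c != 0 ->
  walsh (fc c) (row_mx beta (phi c y)) = 2 ^+ t * sgn (dot beta y).
Proof.
move=> /phi_inj inj; rewrite walsh_fc; congr (_ * _).
by under eq_bigl do rewrite (inj_eq inj); rewrite big_pred1_eq.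
Qed.

Lemma plateaued_fc c : c != 0 -> plateaued_with t (fc c).
Proof.
move=> nz v; rewrite -[v]hsubmxK.
(* By injectivity of [phi c], either a single [y] contributes and the value is [2^t] up to sign, or
   none does and the value is 0. *)
have [[y <-]|no] : (exists y, phi c y = rsubmx v) \/
    (forall y, phi c y != rsubmx v).
  case: (boolP [exists y, phi c y == rsubmx v]) => [/existsP[y /eqP e]|].
    by left; exists y.
  by rewrite negb_exists => /forallP; right.
- rewrite walsh_fc_phi //.
  case: (sgn_cases (dot (lsubmx v) y)) => ->; rewrite ?mulr1 ?mulrN1.
    by constructor 2.
  by constructor 3.
- by constructor 1; rewrite walsh_fc big_pred0 ?mulr0 // => y; apply/negbTE.
Qed.

(** * The spectrum of [gc] and the transfer of orthogonality *)

Hypothesis H_bent : vectorial_bent H.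

Lemma plateaued_gc c : c != 0 -> plateaued_with (u %/ 2 + t) (gc c).
Proof.
move=> nz v; rewrite -[v]hsubmxK walsh_gc exprD.
have [_ /(_ (lsubmx v)) hb] := H_bent nz.
have fb := plateaued_fc nz (rsubmx v).
case: hb => ->; case: fb => ->; rewrite ?mulr0 ?mulNr ?mulrN ?opprK;
  by [constructor 1 | constructor 2 | constructor 3].
Qed.

(** Includes [c = 0], where the value is [2^u]; this lets the factor from [H] be cancelled for every
    pair of indices, equal ones included. *)
Lemma walsh_hc_neq0 c : walsh (hc c) 0 != 0.
Proof.
have [->|nz] := eqVneq c 0; first by rewrite lincomb0 walsh0 eqxx expf_neq0.
by have [_ /(_ 0) [] ->] := H_bent nz; rewrite ?oppr_eq0 expf_neq0.
Qed.

Lemma orthogonal_Sset' c alpha e delta :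
  orthogonal_sets (Sset' s gamma pi H c alpha) (Sset' s gamma pi H e delta)
  <-> orthogonal_sets (Sset s gamma pi c alpha) (Sset s gamma pi e delta).
Proof.
split=> orth a b.
  case/SsetP=> b1 -> /SsetP[b2 ->]; rewrite /orthogonal_seq inner_twist fcD.
  (* Both [z]-parts are chosen to be 0, so the factor contributed by [H] is its Walsh coefficient at
     0, which is nonzero. *)
  have /eqP := orth _ _
    (introT (Sset'P _ _ _) (ex_intro _ 0 (ex_intro _ b1 erefl)))
    (introT (Sset'P _ _ _) (ex_intro _ 0 (ex_intro _ b2 erefl))).
  rewrite inner_twist gcD add_row_mx addr0 walsh_gc.
  by rewrite mulf_eq0 (negPf (walsh_hc_neq0 _)) => /eqP.
case/Sset'P=> w1 [b1 ->] /Sset'P[w2 [b2 ->]].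
have := orth _ _ (introT (SsetP _ _ _) (ex_intro _ b1 erefl))
          (introT (SsetP _ _ _) (ex_intro _ b2 erefl)).
rewrite /orthogonal_seq !inner_twist fcD gcD !add_row_mx walsh_gc => ->.
by rewrite mulr0.
Qed.

End Sets.

Theorem theorem2 (m s t u : nat) (F : finFieldType) (gamma : F)
    (pi : {additive F -> 'rV['F_2]_t}) (H : 'rV['F_2]_u -> 'rV['F_2]_t)
    (m_gt0 : (0 < m)%N) (s_gt0 : (0 < s)%N) (t_gt0 : (0 < t)%N)
    (m_def : m = (s + t)%N) (s_lt_t : (s < t)%N)
    (u_ge : (2 * t <= u)%N) (u_even : ~~ odd u)
    (F_card : #|F| = (2 ^ t)%N)
    (gamma_prim : ((2 ^ t).-1).-primitive_root gamma)
    (pi_coord : basis_coordinates gamma pi)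
    (H_bent : vectorial_bent H) :
  (forall c alpha e delta : 'rV['F_2]_t,
     orthogonal_sets (Sset' s gamma pi H c alpha) (Sset' s gamma pi H e delta)
     <-> orthogonal_sets (Sset s gamma pi c alpha) (Sset s gamma pi e delta))
  /\
  (forall c alpha : 'rV['F_2]_t,
     [/\ forall a, a \in Sset' s gamma pi H c alpha -> plateaued_seq a,
         forall a b : sequence _, a \in Sset' s gamma pi H c alpha ->
           b \in Sset' s gamma pi H c alpha -> a <> b -> orthogonal_seq a b
       & (#|` Sset' s gamma pi H c alpha|)%:R / (#|` Sset s gamma pi c alpha|)%:R
         = 2 ^+ u :> rat])
  /\
  (t = ((m + 2) %/ 2)%N ->
     (forall c alpha : 'rV['F_2]_t, c != 0 ->
        forall a, a \in Sset' s gamma pi H c alpha -> semibent_seq a)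
     /\
     (forall (c alpha e delta : 'rV['F_2]_t) (a b : sequence _),
        a \in Sset' s gamma pi H c alpha ->
        b \in Sset' s gamma pi H e delta ->
        a <> b -> ~ orthogonal_seq a b ->
        `|inner a b| <= 2 ^+ ((m + u + 2) %/ 2))
     /\
     (exists (c alpha e delta : 'rV['F_2]_t) (a b : sequence _),
        [/\ a \in Sset' s gamma pi H c alpha,
            b \in Sset' s gamma pi H e delta,
            a <> b, ~ orthogonal_seq a b
          & `|inner a b| = 2 ^+ ((m + u + 2) %/ 2)])).
Proof.
(* Evenness of [u] lets [u] be split off from the floor. *)
have lamE : t = ((m + 2) %/ 2)%N -> ((m + u + 2) %/ 2 = u %/ 2 + t)%N.
  by move=> ->; rewrite addnAC divnDr ?dvdn2 // addnC.
split; first exact: orthogonal_Sset'.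
split=> [c alpha|t_def].
  split.
  - move=> _ /Sset'P[w [beta ->]].
    set v := row_mx _ _; exists (twist (gc s gamma pi H c) v) => //.
    (* For [c = 0] the exponent is the full dimension [u + (s + t)]; otherwise it is [u / 2 + t],
       which is at least half the dimension because [s < t]. *)
    have [->|nz] := eqVneq c 0.
      exists (u + (s + t))%N; rewrite gc0.
      split; first by rewrite !addn_gt0 s_gt0 orbT.
        by rewrite mul2n -addnn leq_addr.
      exact/plateaued_with_twist/plateaued_with0.
    exists (u %/ 2 + t)%N; split; first by rewrite addn_gt0 t_gt0 orbT.
      rewrite mulnDr mulnC divnK ?dvdn2 // leq_add2l mul2n -addnn leq_add2r.
      exact: ltnW.
    exact/plateaued_with_twist/plateaued_gc.
  - move=> _ _ /Sset'P[w [b ->]] /Sset'P[w' [b' ->]].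
    exact: inner_twist_same.
  - rewrite card_Sset card_Sset' expnD natrM !natrX mulfK //.
    by rewrite expf_neq0.
split; last split.
(* At [c = 0] the twists are linear, with a Walsh coefficient [2^(u+s+t)] beyond the semi-bent
   amplitude; hence the restriction to nonzero [c]. *)
- move=> c alpha nz _ /Sset'P[w [beta ->]].
  set v := row_mx _ _; exists (twist (gc s gamma pi H c) v) => //.
  rewrite /semibent (_ : (u + (s + t) + 2) %/ 2 = u %/ 2 + t)%N.
    exact/plateaued_with_twist/plateaued_gc.
  by rewrite -m_def [(u + m)%N]addnC lamE.
- move=> c alpha e delta _ _ /Sset'P[w [b ->]] /Sset'P[w' [b' ->]].
  (* With equal first indices, distinct sequences are orthogonal even when [alpha] and [delta]
     differ, so a non-orthogonal pair has [c + e] nonzero. *)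
  have [<-|ne] := eqVneq c e; first by move=> /inner_twist_same.
  move=> _ _; rewrite inner_twist gcD lamE //.
  have nz : c + e != 0 by rewrite rowF2_eq.
  set x := (_ + _ : 'rV_(u + _)).
  case: (plateaued_gc s_lt_t gamma_prim pi_coord H_bent nz x) => ->.
  + by rewrite normr0 exprn_ge0.
  + by rewrite ger0_norm // exprn_ge0.
  + by rewrite normrN ger0_norm // exprn_ge0.
(* The bound is attained by a nonzero [c] (here all ones) against the constant sequence [b]:
   twisting by [phi c 0] places the inner product at a nonzero coefficient of [fc]. *)
- pose c : 'rV['F_2]_t := const_mx 1.
  have nz : c != 0.
    by apply/rV0Pn; exists (Ordinal t_gt0); rewrite mxE.
  pose alpha := phi gamma pi c (0 : 'rV_s).
  pose v := row_mx (0 : 'rV['F_2]_u) (row_mx (0 : 'rV['F_2]_s) alpha).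
  pose a := seq_of (twist (gc s gamma pi H c) v).
  pose b := seq_of (twist (gc s gamma pi H 0) 0).
  have abn : `|inner a b| = 2 ^+ ((m + u + 2) %/ 2).
    rewrite inner_twist gcD !addr0 walsh_gc walsh_fc_phi // dot0l mulr1 lamE //.
    by have [_ /(_ 0) [] ->] := H_bent _ nz;
      rewrite ?mulNr ?normrN -exprD ger0_norm ?exprn_ge0.
  exists c, alpha, 0, 0, a, b; split=> //.
  + by apply/Sset'P; exists 0, 0.
  + by apply/Sset'P; exists 0, 0; rewrite !row_mx0.
  (* If [a = b], the inner product would be the full length [2^(u+s+t)], while the exponent in [abn]
     is [u / 2 + t]; these differ since [u / 2 <= u < u + s]. *)
  + move=> ab; move: abn; rewrite -ab inner_twist gcD !rowF2D gc0 walsh0 eqxx.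
    have exp2_inj : injective (GRing.exp (2 : int)) by apply: ieexprIn.
    rewrite ger0_norm ?exprn_ge0 // lamE // => /exp2_inj /eqP.
    rewrite addnA eqn_add2r gtn_eqF // (leq_ltn_trans (leq_div u 2)) //.
    by rewrite -[ltnLHS]addn0 ltn_add2l.
  + by move=> ab0; move: abn; rewrite ab0 normr0 => /esym/eqP;
      rewrite expf_eq0 andbF.
Qed.
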